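(* Every path-connected uniform space $X$ has a universal Peano space. It is the set $X$ equipped with the uniform structure generated by (i.e. with base) $\{pc(E)\}_E$, where $E$ ranges over the entourages of $X$ and $pc(E)$ is the set of pairs $(x,y)\in X\times X$ that can be connected by an $E$-bounded path in $X$ (together with the identity function to $X$).
   Context: Entourages of uniform structures are taken to be symmetric. For an entourage $E$ of $X$, $B(x,E)=\{y\in X : (x,y)\in E\}$; a subset (or a path, via its image) is $E$-bounded if it is contained in $B(x,E)$ for some $x\in X$. A uniform space $X$ is uniformly locally path-connected if for every entourage $E$ there is an entourage $F$ such that any pair $(x,y)\in F$ can be connected by an $E$-bounded path in $X$. A uniform Peano space is a uniform space that is uniformly locally path-connected and connected. A universal Peano space of a uniform space $X$ is a uniform Peano space $P(X)$ together with a uniformly continuous map $\pi\colon P(X)\to X$ such that for any uniformly continuous map $f\colon Y\to X$ from a uniform Peano space $Y$ there is a unique uniformly continuous lift $g\colon Y\to P(X)$ of $f$ (that is, $\pi\circ g=f$). *)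

(* Defs.v *)
From HB Require Import structures.
From mathcomp Require Import all_boot all_order all_algebra.
From mathcomp Require Import all_classical all_reals topology normedtype.

Set Implicit Arguments.
Unset Strict Implicit.
Unset Printing Implicit Defensive.

Import Order.TTheory GRing.Theory Num.Theory.
Import numFieldNormedType.Exports.
Local Open Scope classical_set_scope.
Local Open Scope ring_scope.

(* Entourages are taken to be symmetric here; the library's
   [entourage] is the full filter, whose symmetric members form a base of it. *)
Definition sym_entourage (X : uniformType) (E : set (X * X)) : Prop :=
  entourage E /\ (E^-1)%relation = E.

(* [xsection E a] is the ball B(a, E). *)
Definition ent_bounded (X : uniformType) (E : set (X * X)) (A : set X) : Prop :=
  exists a : X, A `<=` xsection E a.

(* A path is a function on the whole of R of which only the restriction to
   [0, 1] is meaningful. *)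
Definition is_path (R : realType) (X : topologicalType) (c : R -> X)
    (x y : X) : Prop :=
  [/\ {within `[0, 1], continuous c}, c 0 = x & c 1 = y].

Definition path_connected (R : realType) (X : topologicalType) : Prop :=
  forall x y : X, exists c : R -> X, is_path c x y.

Definition pc (R : realType) (X : uniformType) (E : set (X * X)) :
    set (X * X) :=
  [set p | exists2 c : R -> X, is_path c p.1 p.2 & ent_bounded E (c @` `[0, 1])].

Definition unif_locally_path_connected (R : realType) (X : uniformType) : Prop :=
  forall E : set (X * X), sym_entourage E ->
  exists2 F : set (X * X), sym_entourage F & F `<=` pc R E.

Definition uniform_peano (R : realType) (X : uniformType) : Prop :=
  unif_locally_path_connected R X /\ connected [set: X].

Definition universal_peano (R : realType) (X P : uniformType) (pi : P -> X) :
    Prop :=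
  [/\ uniform_peano R P,
      unif_continuous pi &
      forall (Y : uniformType) (f : Y -> X),
        uniform_peano R Y -> unif_continuous f ->
        exists! g : Y -> P, unif_continuous g /\ pi \o g = f].

(* Main.v *)
Require Import Defs.
From HB Require Import structures.
From mathcomp Require Import all_boot all_order all_algebra.
From mathcomp Require Import all_classical all_reals topology normedtype.
From mathcomp Require Import lra.

Set Implicit Arguments.
Unset Strict Implicit.
Unset Printing Implicit Defensive.

Import Order.TTheory GRing.Theory Num.Theory.
Import numFieldNormedType.Exports.
Local Open Scope classical_set_scope.
Local Open Scope ring_scope.

(** The sets [pc E] form a base of a uniformity on the carrier of [X]: constant
    paths give reflexivity, reversed paths give symmetry, and concatenated paths
    give the composition axiom. In the last case the two paths meet at a point
    [z], and if both are [F]-bounded, with [F] symmetric, then their union lies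
    in the ball of radius [F \; F] about [z], so concatenation costs only one
    halving of the entourage ([pc_split]). The new uniformity is finer than the old one,
    because the
    endpoints of an [F]-bounded path are [F \; F]-close ([entourage_pc]); so the
    identity is uniformly continuous.

    The key point is that refining the uniformity destroys no path
    ([is_path_peano]): if [c] is continuous at [t] for the old uniformity, then
    for [s] near [t] the piece of [c] between [t] and [s] stays in a small ball
    about [c t], and this piece is itself a witness that [c t] and [c s] are
    close for the new uniformity. Moreover an [E]-bounded path of [X] starting
    at [x] lies in the [pc E]-ball about [x], since its initial pieces are
    [E]-bounded too. Hence two [pc E]-close points are joined by a
    [pc E]-bounded path of the refinement ([pc_peano]), which makes the
    refinement uniformly locally
    path-connected. It is connected because it is path-connected, like [X].

    For the universal property, the lift of [f : Y -> X] can only be [f] itself.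
    It is uniformly continuous into the refinement because [f] maps paths of [Y]
    bounded by the preimage of [E] to [E]-bounded paths, and points of [Y] that
    are close enough are joined by such paths ([unif_continuous_peano]). *)

(** * Paths on the unit interval *)

Section Paths.
Context {R : realType} {X : topologicalType}.
Implicit Types (c d : R -> X) (x y z : X).

Lemma is_path_cst x : is_path (fun _ : R => x) x x.
Proof. by split => //; apply: continuous_subspaceT => t; exact: cvg_cst. Qed.

Lemma is_path_image_start c x y : is_path c x y -> (c @` `[0, 1]) x.
Proof. by case=> _ <- _; exists 0 => //=; rewrite in_itv /= lexx ler01. Qed.

Lemma is_path_image_end c x y : is_path c x y -> (c @` `[0, 1]) y.
Proof. by case=> _ _ <-; exists 1 => //=; rewrite in_itv /= lexx ler01. Qed.

Lemma within_continuous_reparam (A B : set R) (p : R -> R) c :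
  continuous p -> p @` A `<=` B -> {within B, continuous c} ->
  {within A, continuous (c \o p)}.
Proof.
move=> cp pAB /subspace_continuousP cc; apply/subspace_continuousP => t At.
have Bpt : B (p t) by apply: pAB; exists t.
move=> W cW; have := cp t _ (cc _ Bpt _ cW).
rewrite /= !nbhs_simpl /= /within /= => nW.
apply: filterS nW => s /= Ws As.
by apply: Ws; apply: pAB; exists s.
Qed.

(** All reparametrizations below are written [a + t * b], so that this lemma
    covers their continuity. *)
Lemma affine_continuous (a b : R) : continuous (fun t : R => a + t * b).
Proof. by move=> t; apply: cvgD; [exact: cvg_cst|exact: mulrr_continuous]. Qed.

(** The order of [a] and [b] is arbitrary: for [b < a] the piece of [c] is
    run backwards, which covers path reversal and pieces on either side of a
    given time. *)
Definition subpath c (a b t : R) : X := c (a + t * (b - a)).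

Lemma is_path_subpath c x y (a b : R) : is_path c x y ->
  0 <= a <= 1 -> 0 <= b <= 1 -> is_path (subpath c a b) (c a) (c b).
Proof.
case=> cc _ _ a01 b01; split.
- apply: within_continuous_reparam cc; first exact: affine_continuous.
  by move=> _ [t /= + <-]; rewrite /= !in_itv /=; nra.
- by rewrite /subpath mul0r addr0.
- by rewrite /subpath mul1r addrC subrK.
Qed.

Lemma subpath_image c (a b : R) : 0 <= a <= 1 -> 0 <= b <= 1 ->
  subpath c a b @` `[0, 1] `<=` c @` `[0, 1].
Proof.
move=> a01 b01 _ [t /= + <-]; rewrite in_itv /= => t01.
by exists (a + t * (b - a)) => //=; rewrite in_itv /=; nra.
Qed.

Lemma is_path_rev c x y : is_path c x y -> is_path (subpath c 1 0) y x.
Proof.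
move=> cxy; have [_ c0 c1] := cxy.
by have := is_path_subpath (a := 1) (b := 0) cxy; rewrite c0 c1; apply; lra.
Qed.

Definition catpath c d (t : R) : X :=
  if t <= 2^-1 then c (0 + t * 2) else d (-1 + t * 2).

Lemma is_path_catpath c d x y z :
  is_path c x y -> is_path d y z -> is_path (catpath c d) x z.
Proof.
case=> cc c0 c1 [dc d0 d1]; split; last 2 first.
- by rewrite /catpath ifT ?mul0r ?add0r//; lra.
- rewrite /catpath ifF; last by apply/negbTE; lra.
  by rewrite -d1; congr d; lra.
have -> : `[0, 1]%classic = `[0, 2^-1]%classic `|` `[2^-1, 1] :> set R.
  by apply/seteqP; split => t /=; rewrite !in_itv /=;
    [case: (lerP t 2^-1) => ? ?; [left|right]|case]; lra.
apply: withinU_continuous; [exact: interval_closed..| |].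
- apply: (@subspace_eq_continuous _ _ _ (c \o (fun t => 0 + t * 2))).
    move=> t; rewrite inE /= in_itv /= /catpath /from_subspace.
    by case/andP => _ ->.
  apply: within_continuous_reparam cc; first exact: affine_continuous.
  by move=> _ [t /= + <-]; rewrite /= !in_itv /=; lra.
- (* At [t = 2^-1] the definition takes the value [c 1], which is [d 0]. *)
  apply: (@subspace_eq_continuous _ _ _ (d \o (fun t => -1 + t * 2))).
    move=> t; rewrite inE /= in_itv /= /catpath /from_subspace => /andP[t2 _].
    case: ifPn => // t2'; have -> : t = 2^-1 by apply/eqP; rewrite eq_le t2 t2'.
    by rewrite add0r mulVf ?pnatr_eq0// addNr d0 c1.
  apply: within_continuous_reparam dc; first exact: affine_continuous.
  by move=> _ [t /= + <-]; rewrite /= !in_itv /=; lra.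
Qed.

Lemma catpath_image c d :
  catpath c d @` `[0, 1] `<=` c @` `[0, 1] `|` d @` `[0, 1].
Proof.
move=> _ [t /= + <-]; rewrite in_itv /= /catpath => t01.
case: (lerP t 2^-1) => ?; [left|right]; (eexists; last reflexivity);
  rewrite /= in_itv /=; lra.
Qed.

Lemma is_path_comp {Y : topologicalType} (f : X -> Y) c x y :
  continuous f -> is_path c x y -> is_path (f \o c) (f x) (f y).
Proof.
move=> cf [cc <- <-]; split => //.
by apply: within_continuous_comp cc => t _; exact: cf.
Qed.

(** The space is the union of the images of paths from one fixed point; these
    images are connected and share that point. *)
Lemma path_connected_connected :
  path_connected R X -> connected [set: X].
Proof.
move=> pcX; have [[x _]|/nonemptyPn->] := pselect ([set: X] !=set0); last first.
  exact: connected0.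
pose A y := projT1 (cid (pcX x y)) @` `[0, 1].
have -> : [set: X] = \bigcup_(y in setT) A y.
  apply/seteqP; split => // y _; exists y => //.
  exact: is_path_image_end (projT2 (cid (pcX x y))).
apply: bigcup_connected.
  by exists x => y _; exact: is_path_image_start (projT2 (cid (pcX x y))).
move=> y _; have [cc _ _] := projT2 (cid (pcX x y)).
by apply: connected_continuous_connected cc; exact: segment_connected.
Qed.

End Paths.

Lemma unif_continuousW {X Y : uniformType} (f : X -> Y) :
  unif_continuous f -> continuous f.
Proof.
move=> uf x; apply/cvg_app_entourageP => A eA.
exact: (cvg_entourage (F := nbhs x) _ (uf A eA)).
Qed.

(** * The relations [pc E] *)

Section Pc.
Context {R : realType} {X : uniformType}.
Local Open Scope relation_scope.
Implicit Types E F : set (X * X).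

Lemma sym_entourage_split E : entourage E ->
  exists2 F, sym_entourage F & F \; F `<=` E.
Proof.
move=> /entourage_split_ex[F eF FE]; exists (F `&` F^-1).
  split; first exact: entourage_invI.
  by apply/seteqP; split=> -[a b] [].
by move=> [a b] [m [? _] [? _]]; apply: FE; exists m.
Qed.

Lemma sym_entourageC E (x y : X) : sym_entourage E -> E (x, y) -> E (y, x).
Proof. by case=> _ {1}<-. Qed.

Lemma sym_entourageI E F :
  sym_entourage E -> sym_entourage F -> sym_entourage (E `&` F).
Proof.
move=> sE sF; split; first by apply: filterI; [case: sE|case: sF].
by apply/seteqP; split=> -[a b] [] ? ?; split; exact: sym_entourageC.
Qed.

Lemma ent_bounded_sub E F (A B : set X) :
  E `<=` F -> A `<=` B -> ent_bounded E B -> ent_bounded F A.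
Proof.
move=> EF AB [a Ba]; exists a => x /AB /Ba /xsectionP Eax.
by apply/xsectionP; exact: EF.
Qed.

Lemma ent_bounded_image {Y : uniformType} (f : Y -> X) E (A : set Y) :
  ent_bounded ((fun p => (f p.1, f p.2)) @^-1` E) A -> ent_bounded E (f @` A).
Proof.
move=> [a Aa]; exists (f a) => _ [y Ay <-].
by apply/xsectionP; have /xsectionP := Aa y Ay.
Qed.

Lemma sub_pc E F : E `<=` F -> pc R E `<=` pc R F.
Proof.
by move=> EF p [c cp cE]; exists c => //; exact: ent_bounded_sub cE.
Qed.

Lemma pc_refl E (x : X) : entourage E -> pc R E (x, x).
Proof.
move=> eE; exists (fun=> x); first exact: is_path_cst.
by exists x => _ [t _ <-]; apply/xsectionP; exact: entourage_refl.
Qed.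

Lemma pc_sym E (x y : X) : pc R E (x, y) -> pc R E (y, x).
Proof.
move=> [c cxy cE]; exists (subpath c 1 0); first exact: is_path_rev cxy.
apply: ent_bounded_sub cE => //; apply: subpath_image; lra.
Qed.

(** Concatenation of two [F]-bounded paths: balls of different centers are
    compared by recentering both at the common point of the paths. *)
Lemma pc_split E : sym_entourage E ->
  exists2 F, sym_entourage F & pc R F \; pc R F `<=` pc R E.
Proof.
move=> [eE _]; have [F sF FE] := sym_entourage_split eE; exists F => //.
move=> [x y] [z /= [c cxz [a ca]] [d dzy [b db]]].
exists (catpath c d); first exact: is_path_catpath cxz dzy.
have near_z (e : X) A : A z -> A `<=` xsection F e -> A `<=` xsection E z.
  move=> Az AF w Aw; apply/xsectionP/FE; exists e => /=.
    by apply: sym_entourageC => //; exact/xsectionP/AF.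
  exact/xsectionP/AF.
exists z; apply: subset_trans (@catpath_image _ _ c d) _.
rewrite subUset; split.
  exact: near_z (is_path_image_end cxz) ca.
exact: near_z (is_path_image_start dzy) db.
Qed.

Lemma pc_base_filter : Filter (filter_from (@sym_entourage X) (@pc R X)).
Proof.
apply: filter_from_filter.
  by exists setT; split; [exact: entourageT|apply/seteqP; split].
move=> E F sE sF; exists (E `&` F); first exact: sym_entourageI.
by rewrite subsetI; split; apply: sub_pc => ? [].
Qed.

(** The uniformity with base the [pc E] is finer than that of [X]: both
    endpoints of an [F]-bounded path are [F]-close to the center of the ball. *)
Lemma entourage_pc E : entourage E ->
  exists2 F, sym_entourage F & pc R F `<=` E.
Proof.
move=> eE; have [F sF FE] := sym_entourage_split eE; exists F => //.
move=> [x y] [c cxy [a ca]]; apply: FE; exists a.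
  apply: sym_entourageC => //.
  exact/xsectionP/ca/(is_path_image_start cxy).
exact/xsectionP/ca/(is_path_image_end cxy).
Qed.

End Pc.

(** * The refined uniform structure *)

(** A copy of the carrier of [X] that bears the second uniform structure; [R] is
    an argument because the notion of path depends on it. *)
Definition peano_refinement (R : realType) (X : uniformType) : Type := X.

Section PeanoRefinement.
Context {R : realType} {X : uniformType}.
Local Notation PX := (peano_refinement R X).
Local Notation ent := (filter_from (@sym_entourage X) (@pc R X)).
Local Open Scope relation_scope.

Lemma peano_diagonal (A : set (X * X)) : ent A -> diagonal `<=` A.
Proof.
by move=> [E [eE _] EA] [x y] /diagonalP ->; apply: EA; exact: pc_refl.
Qed.

Lemma peano_inv (A : set (X * X)) : ent A -> ent A^-1.
Proof. by move=> [E sE EA]; exists E => // -[x y] /pc_sym /EA. Qed.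

Lemma peano_split (A : set (X * X)) : ent A -> exists2 B, ent B & B \; B `<=` A.
Proof.
move=> [E sE EA]; have [F sF FE] := pc_split (R := R) sE; exists (pc R F).
  by exists F.
exact: subset_trans FE EA.
Qed.

HB.instance Definition _ := Choice.copy PX X.
HB.instance Definition _ := @isUniform.Build PX ent
  pc_base_filter peano_diagonal peano_inv peano_split.

Lemma peano_entourage_pc (E : set (X * X)) :
  sym_entourage E -> sym_entourage (pc R E : set (PX * PX)).
Proof.
move=> sE; split; first by exists E.
by apply/seteqP; split => -[x y] /pc_sym.
Qed.

(** Paths of [X] are continuous for the finer uniformity: when [c] sends a
    ball around [t] into the [E]-ball about [c t], the affine piece from [t] to
    [s] never leaves that ball, so it joins [c t] to [c s] within it. *)
Lemma is_path_peano (c : R -> X) (x y : X) :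
  is_path c x y -> is_path (c : R -> PX) x y.
Proof.
move=> cxy; have [cc c0 c1] := cxy; split => //.
apply/subspace_continuousP => t; rewrite /= in_itv /= => t01.
apply/cvg_app_entourageP => A [E sE EA].
have := (subspace_continuousP _ _).1 cc t.
rewrite /= in_itv /= => /(_ t01)/cvg_app_entourageP/(_ E sE.1).
rewrite near_withinE => /nbhs_ballP[e /= e0 ce].
apply/nbhs_ballP; exists e => //= s /=; rewrite /ball /= in_itv /= => ts s01.
apply: EA; exists (subpath c t s); first exact: is_path_subpath cxy _ _.
exists (c t) => _ [u /= + <-]; rewrite in_itv /= => /andP[u0 u1].
(* The parameter [t + u * (s - t)] is no farther from [t] than [s] is. *)
apply/xsectionP/ce => /=; last by rewrite in_itv /=; nra.
rewrite /ball /= opprD addrA subrr add0r normrN normrM (ger0_norm u0) distrC.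
by apply: le_lt_trans ts; rewrite ler_piMl.
Qed.

(** The start [x] of an [E]-bounded path can serve as center in the refinement:
    the initial piece ending at any point of the path lies in the same [E]-ball,
    hence that point is [pc E]-close to [x]. *)
Lemma pc_peano (E : set (X * X)) :
  pc R E `<=` (pc R (pc R E : set (PX * PX)) : set (PX * PX)).
Proof.
move=> [x y] [c cxy cE]; exists c; first exact: is_path_peano.
exists x => _ [t /= + <-]; rewrite in_itv /= => t01.
have z01 : 0 <= (0 : R) <= 1 by lra.
apply/xsectionP; exists (subpath c 0 t).
  by have := is_path_subpath cxy z01 t01; have [_ -> _] := cxy.
by apply: ent_bounded_sub cE => //; exact: subpath_image.
Qed.

Lemma peano_unif_locally_path_connected : unif_locally_path_connected R PX.
Proof.
move=> A [[E sE EA] _]; exists (pc R E); first exact: peano_entourage_pc.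
exact: subset_trans (@pc_peano E) (@sub_pc R PX _ _ EA).
Qed.

Lemma peano_path_connected :
  path_connected R X -> path_connected R PX.
Proof.
by move=> pcX x y; have [c cxy] := pcX x y; exists c; exact: is_path_peano.
Qed.

Lemma peano_id_unif_continuous : unif_continuous (fun x : PX => x : X).
Proof.
move=> E /entourage_pc - /(_ R)[F sF FE]; exists F => //.
by move=> [x y] /FE.
Qed.

(** Uniform local path-connectedness of [Y], applied to the preimage of [E],
    turns closeness in [Y] into a path whose image under [f] is [E]-bounded. *)
Lemma unif_continuous_peano {Y : uniformType} (f : Y -> X) :
  unif_locally_path_connected R Y -> unif_continuous f ->
  unif_continuous (f : Y -> PX).
Proof.
move=> lY uf A [E sE EA].
have /lY[F [eF _] FE] : sym_entourage ((fun p => (f p.1, f p.2)) @^-1` E).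
  split; first exact: uf sE.1.
  by apply/seteqP; split => -[x y] /=; exact: sym_entourageC.
apply: filterS eF => -[x y] /FE[c cxy cE]; apply: EA; exists (f \o c).
  by apply: is_path_comp => //; exact: unif_continuousW.
by rewrite -image_comp; exact: ent_bounded_image.
Qed.

End PeanoRefinement.

(** * The universal Peano space *)

(* [c] is a uniform structure on the carrier of X, packed as the space PX. *)
Theorem theorem3p3 (R : realType) (X : uniformType) :
  path_connected R X ->
  exists c : Uniform X,
    let PX : uniformType := Uniform.Pack c in
    @entourage PX = filter_from (@sym_entourage X) (@pc R X) /\
    @universal_peano R X PX (fun x : X => x).
Proof.
move=> pcX; exists (Uniform.class (peano_refinement R X)) => /=.
split; first by [].
split.
- split; first exact: peano_unif_locally_path_connected.
  exact/path_connected_connected/peano_path_connected/pcX.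
- exact: peano_id_unif_continuous.
move=> Y f [lY _] uf; exists f; split; last by move=> g [_].
by split => //; exact: unif_continuous_peano.
Qed.
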